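(* Let $Q$ be a finite group acting transitively on a finite set $X$ of size $d\ge 2$. The following properties are equivalent: (i) the finite group $Q$ is perfect; (ii) the profinite group $W^{\mathrm{prof}}(Q)$ is rigid.
   Context: For a topological group $G$ and $n\ge1$, $r_n(G)\in\{0,1,2,\dots,\infty\}$ is the number of equivalence classes of continuous irreducible complex linear representations of $G$ of degree $n$. $G$ is rigid if $r_n(G)<\infty$ for all $n\ge1$. For a group $H$ and a group $Q$ acting on $X$, $H\wr_X Q=H^X\rtimes Q$ with $Q$ acting on the group of maps $X \to H$ by $(qb)(x)=b(q^{-1}x)$. Define $W(Q,0)=\{1\}$, $W(Q,1)=Q$ and $W(Q,k+1)=W(Q,k)\wr_X Q$ for $k\ge0$. There are natural epimorphisms $p_k:W(Q,k+1)\to W(Q,k)$: $p_0$ is the trivial map, and for $k\ge1$ $p_k(b,q)=(p_{k-1}\circ b,\,q)$ for $b\in W(Q,k)^X$, $q\in Q$. The profinite group is $W^{\mathrm{prof}}(Q)=\varprojlim_k W(Q,k)$. *)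

(* Defs.v *)
From HB Require Import structures.
From mathcomp Require Import all_boot all_order all_algebra all_fingroup.
From mathcomp Require Import all_solvable.
From mathcomp Require Import all_classical all_reals all_analysis.
From mathcomp Require Import complex.
Set Implicit Arguments.
Unset Strict Implicit.
Unset Printing Implicit Defensive.
Import Order.TTheory GRing.Theory Num.Theory GroupScope.
Import numFieldNormedType.Exports.

Local Open Scope ring_scope.
Local Open Scope group_scope.
Local Open Scope classical_set_scope.

Definition perfect (gT : finGroupType) (G : {set gT}) : bool := [~: G, G] == G.

(* Library actions are right actions; this is the corresponding left action. *)
Definition lact (Q : finGroupType) (X : finType) (to : {action Q &-> X})
  (q : Q) (x : X) : X := to x q^-1.

Section LeftAction.
Variables (Q : finGroupType) (X : finType) (to : {action Q &-> X}).

Lemma lact1 x : lact to 1 x = x.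
Proof. by rewrite /lact invg1 act1. Qed.

Lemma lactM q r x : lact to (q * r) x = lact to q (lact to r x).
Proof. by rewrite /lact invMg actM. Qed.

End LeftAction.

(* The action is a parameter of the type because the group law depends on it. *)
Definition wreath (H Q : finGroupType) (X : finType) (to : {action Q &-> X})
  : Type := ({ffun X -> H} * Q)%type.

Section Wreath.
Variables (H Q : finGroupType) (X : finType) (to : {action Q &-> X}).
Local Notation W := (wreath H to).

HB.instance Definition _ := Finite.copy W ({ffun X -> H} * Q)%type.

(* (q b)(x) = b (q^-1 x) *)
Definition wreath_shift (q : Q) (b : {ffun X -> H}) : {ffun X -> H} :=
  [ffun x => b (lact to q^-1 x)].

Definition wreath_mul (u v : W) : W :=
  ([ffun x => u.1 x * wreath_shift u.2 v.1 x], u.2 * v.2).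
Definition wreath_one : W := ([ffun=> 1], 1).
Definition wreath_inv (u : W) : W :=
  (wreath_shift u.2^-1 [ffun x => (u.1 x)^-1], u.2^-1).

Lemma wreath_mulA : associative wreath_mul.
Proof.
move=> [a q] [b r] [c s]; congr (_, _); last exact: mulgA.
by apply/ffunP=> x; rewrite !ffunE /= invMg lactM mulgA.
Qed.

Lemma wreath_mul1 : left_id wreath_one wreath_mul.
Proof.
move=> [b q]; congr (_, _); last exact: mul1g.
by apply/ffunP=> x; rewrite !ffunE /= invg1 lact1 mul1g.
Qed.

Lemma wreath_mulV : left_inverse wreath_one wreath_inv wreath_mul.
Proof.
move=> [b q]; congr (_, _); last exact: mulVg.
by apply/ffunP=> x; rewrite !ffunE /= mulVg.
Qed.

HB.instance Definition _ :=
  Finite_isGroup.Build W wreath_mulA wreath_mul1 wreath_mulV.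

End Wreath.

Section Tower.
Variables (Q : finGroupType) (X : finType) (to : {action Q &-> X}).

(* W(Q,1) is the wreath product of the trivial group 'I_1 by Q, identified with
   Q by iter_wreath1_isog. *)
Fixpoint iter_wreath (k : nat) : finGroupType :=
  if k is k'.+1 then wreath (iter_wreath k') to else 'I_1.

Fixpoint iter_wreath_proj (k : nat) : iter_wreath k.+1 -> iter_wreath k :=
  match k return iter_wreath k.+1 -> iter_wreath k with
  | 0 => fun=> 1
  | k'.+1 => fun u => ([ffun x => iter_wreath_proj (u.1 x)], u.2)
  end.

Lemma iter_wreath_projM k : {morph @iter_wreath_proj k : u v / u * v}.
Proof.
elim: k => [|k IHk] u v /=; first by rewrite mulg1.
by congr (_, _); apply/ffunP=> x; rewrite !ffunE IHk; congr (_ * _).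
Qed.

HB.instance Definition _ k := isMultiplicative.Build
  (iter_wreath k.+1) (iter_wreath k) (@iter_wreath_proj k)
  (@iter_wreath_projM k).

Lemma iter_wreath1_isog : [set: iter_wreath 1]%SET \isog [set: Q]%SET.
Proof.
have sndM : {in [set: iter_wreath 1]%SET &,
  {morph (fun u : iter_wreath 1 => u.2) : u v / u * v}} by [].
apply/isogP; exists (Morphism sndM) => /=.
  apply/injmP=> -[a q] [b r] _ _ /= ->; congr (_, _).
  by apply/ffunP=> x; rewrite [a x]ord1 [b x]ord1.
apply/setP=> q; rewrite inE; apply/morphimP.
by exists ([ffun=> 1], q); rewrite ?inE.
Qed.

End Tower.

HB.mixin Record isTopologicalGroup G of Topological G & monoid.Group G := {
  mulg_continuous : continuous (fun x : G * G => x.1 * x.2);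
  invg_continuous : continuous (fun x : G => x^-1)
}.

#[short(type="topologicalGroupType")]
HB.structure Definition TopologicalGroup :=
  {G of Topological G & monoid.Group G & isTopologicalGroup G}.

(* Inverse limit of a tower of finite groups: the compatible sequences, with
   the topology induced by the product of the discrete topologies. *)
Definition invlim (G : nat -> finGroupType)
    (f : forall k, {multiplicative G k.+1 -> G k}) : Type :=
  set_type [set g : prod_topology (fun k => discrete_topology (G k)) |
             forall k, f k (g k.+1) = g k].

Section InverseLimit.
Variables (G : nat -> finGroupType).
Variable f : forall k, {multiplicative G k.+1 -> G k}.
Local Notation L := (invlim f).

HB.instance Definition _ := Topological.on L.

Definition invlim_proj (k : nat) (g : L) : G k := set_val g k.

Lemma invlim_projP k (g : L) : f k (invlim_proj k.+1 g) = invlim_proj k g.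
Proof. exact: (set_mem (valP g)). Qed.

Lemma invlim_eq (g h : L) :
  (forall k, invlim_proj k g = invlim_proj k h) -> g = h.
Proof.
move=> gh; apply: (@val_inj _ _ L).
by apply: functional_extensionality_dep => k; exact: gh.
Qed.

Definition mk_invlim (g : forall k, G k) (fg : forall k, f k (g k.+1) = g k)
  : L := exist _ g (mem_set fg).

Lemma mk_invlimK (g : forall k, G k) fg k : invlim_proj k (@mk_invlim g fg) = g k.
Proof. by []. Qed.

Fact invlim_mul_subproof (g h : L) k :
  f k (invlim_proj k.+1 g * invlim_proj k.+1 h) =
  invlim_proj k g * invlim_proj k h.
Proof. by rewrite gmulfM !invlim_projP. Qed.

Fact invlim_one_subproof k : f k 1 = 1.
Proof. by apply: (mulgI (f k 1)); rewrite -gmulfM !mulg1. Qed.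

Fact invlim_inv_subproof (g : L) k :
  f k (invlim_proj k.+1 g)^-1 = (invlim_proj k g)^-1.
Proof.
apply: (mulgI (f k (invlim_proj k.+1 g))).
by rewrite -gmulfM mulgV invlim_projP mulgV invlim_one_subproof.
Qed.

Definition invlim_mul (g h : L) : L := mk_invlim (invlim_mul_subproof g h).
Definition invlim_one : L := mk_invlim invlim_one_subproof.
Definition invlim_inv (g : L) : L := mk_invlim (invlim_inv_subproof g).

Lemma invlim_mulA : associative invlim_mul.
Proof. by move=> x y z; apply: invlim_eq => k; rewrite !mk_invlimK mulgA. Qed.

Lemma invlim_mul1g : left_id invlim_one invlim_mul.
Proof. by move=> x; apply: invlim_eq => k; rewrite !mk_invlimK mul1g. Qed.

Lemma invlim_mulg1 : right_id invlim_one invlim_mul.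
Proof. by move=> x; apply: invlim_eq => k; rewrite !mk_invlimK mulg1. Qed.

Lemma invlim_mulVg : left_inverse invlim_one invlim_inv invlim_mul.
Proof. by move=> x; apply: invlim_eq => k; rewrite !mk_invlimK mulVg. Qed.

Lemma invlim_mulgV : right_inverse invlim_one invlim_inv invlim_mul.
Proof. by move=> x; apply: invlim_eq => k; rewrite !mk_invlimK mulgV. Qed.

HB.instance Definition _ := isGroup.Build L invlim_mulA invlim_mul1g
  invlim_mulg1 invlim_mulVg invlim_mulgV.

Lemma cvg_invlim (F : set_system L) (g : L) : Filter F ->
  (forall k, \forall h \near F, invlim_proj k h = invlim_proj k g) -> F --> g.
Proof.
move=> FF Fg A [_ [[B oB <-] Bg] /filterS]; apply.
have cvFg : set_val @ F --> set_val g.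
  apply/cvg_sup => k U [_ [[V _ <-] Vg] /filterS]; apply.
  apply: filterS (Fg k) => h hg.
  by rewrite /= /invlim_proj in hg *; rewrite hg.
by apply: cvFg; exact: open_nbhs_nbhs.
Qed.

Lemma near_invlim_proj k (g : L) :
  \forall h \near g, invlim_proj k h = invlim_proj k g.
Proof.
pose D i : topologicalType := discrete_topology (G i).
have cproj := @proj_continuous _ D k (set_val g).
have cval : {for g, continuous (set_val : L -> prod_topology D)}.
  exact: initial_continuous.
exact: (continuous_comp cval cproj (discrete_set1 _)).
Qed.

Lemma invlim_mul_continuous : continuous (fun x : L * L => x.1 * x.2).
Proof.
move=> [x y]; apply: cvg_invlim => k.
exists ([set h | invlim_proj k h = invlim_proj k x],
        [set h | invlim_proj k h = invlim_proj k y]).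
  by split; exact: near_invlim_proj.
by move=> [g h] [/= gx hy]; rewrite !mk_invlimK gx hy.
Qed.

Lemma invlim_inv_continuous : continuous (fun x : L => x^-1).
Proof.
move=> x; have Fx : Filter (nbhs x) := nbhs_filter x.
apply: (cvg_invlim (fmap_filter _ Fx)) => k.
apply: filterS (near_invlim_proj k x) => h /= hx.
by rewrite !mk_invlimK hx.
Qed.

HB.instance Definition _ := isTopologicalGroup.Build L invlim_mul_continuous
  invlim_inv_continuous.

End InverseLimit.

Definition Wprof (Q : finGroupType) (X : finType) (to : {action Q &-> X})
  : topologicalGroupType := invlim (@iter_wreath_proj Q X to).

(* Packing R[i] as a numClosedFieldType gives it, and matrices over it, the
   topology of numFieldType instances; R[i] itself has none by inference. *)
Definition cplx (R : realType) : numClosedFieldType := R[i]%C.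

Section Representations.
Variables (R : realType) (G : topologicalGroupType) (n : nat).
Local Notation C := (cplx R).
Implicit Types rho sigma : G -> 'M[C]_n.

(* Every rho x is then invertible, so rho takes its values in GL_n. *)
Definition linear_rep rho : Prop :=
  rho 1 = 1%:M /\ forall x y, rho (x * y) = rho x *m rho y.

Definition irreducible_rep rho : Prop :=
  (0 < n)%N /\ forall U : {vspace 'cV[C]_n},
    (forall x v, v \in U -> rho x *m v \in U) -> U = 0%VS \/ U = fullv.

Definition equivalent_rep rho sigma : Prop :=
  exists2 P, P \in unitmx & forall x, P *m rho x = sigma x *m P.

(* Continuity into GL_n is continuity of the matrix entries. *)
Definition cont_irr_reps : set (G -> 'M[C]_n) :=
  [set rho | [/\ linear_rep rho, continuous rho & irreducible_rep rho]].

Definition cont_irr_classes : set (set (G -> 'M[C]_n)) :=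
  [set [set sigma | cont_irr_reps sigma /\ equivalent_rep rho sigma]
    | rho in cont_irr_reps].

(* r_n(G), with value +oo when there are infinitely many classes *)
Definition rep_count : \bar R := counting cont_irr_classes.

End Representations.

Definition rigid (R : realType) (G : topologicalGroupType) : Prop :=
  forall n, (1 <= n)%N -> (rep_count R G n < +oo)%E.

(* Main.v *)
(* If Q is perfect, so is H = W(Q,k), and a representation of degree at most n
   of H wr_X Q kills the kernel of the map to W(Q,n), by induction on n: either
   each coordinate copy of H acts reducibly, and Maschke's theorem reduces to
   degree n - 1, or one copy acts irreducibly, and then the others, which
   commute with it, act by scalars (Schur), hence trivially since H is perfect,
   so that by transitivity the whole base group acts trivially.  A continuous
   representation of degree n of W^prof(Q) has an open kernel, because the
   general linear group has no small subgroups; hence it factors through the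
   finite group W(Q,n), which has finitely many irreducible representations.
   If Q is not perfect, it has a nontrivial linear character chi, and the
   products of chi over the vertices of level j, j = 0, 1, ..., are pairwise
   distinct characters of W^prof(Q). *)
Require Import Defs.
From mathcomp Require Import all_classical all_reals topology normedtype.
From mathcomp Require Import measure complex.
From mathcomp Require Import all_boot all_order all_algebra all_fingroup.
From mathcomp Require Import all_solvable mxrepresentation spectral ring zify.
Set Implicit Arguments.
Unset Strict Implicit.
Unset Printing Implicit Defensive.
Import Order.TTheory GRing.Theory Num.Theory GroupScope.
Import numFieldNormedType.Exports.

(** * Coordinate subgroups and perfectness of wreath products *)

Section WreathProduct.
Variables (H Q : finGroupType) (X : finType) (to : {action Q &-> X}).
Local Notation W := (wreath H to).

Definition wreath_coord (x : X) (h : H) : W :=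
  ([ffun y => if y == x then h else 1], 1).
Definition wreath_top (q : Q) : W := ([ffun=> 1], q).

Lemma wreath_mulE (u v : W) :
  u * v = ([ffun x => u.1 x * v.1 (lact to u.2^-1 x)], u.2 * v.2) :> W.
Proof. by congr (_, _); apply/ffunP => x; rewrite !ffunE. Qed.

Lemma wreath_mul_baseE (u v : W) : u.2 = 1 ->
  u * v = ([ffun x => u.1 x * v.1 x], v.2) :> W.
Proof.
move=> u1; rewrite wreath_mulE u1 mul1g; congr (_, _).
by apply/ffunP => x; rewrite !ffunE invg1 lact1.
Qed.

Lemma wreath_coordM x : {morph wreath_coord x : g h / g * h}.
Proof.
move=> g h; rewrite wreath_mul_baseE //; congr (_, _).
by apply/ffunP => y; rewrite !ffunE; case: eqP; rewrite ?mulg1.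
Qed.

Lemma wreath_topM : {morph wreath_top : q r / q * r}.
Proof.
move=> q r; rewrite wreath_mulE; congr (_, _).
by apply/ffunP => y; rewrite !ffunE mulg1.
Qed.

Definition wreath_coord_morphism x : {morphism [set: H] >-> W} :=
  Morphism (in2W (@wreath_coordM x)).
Definition wreath_top_morphism : {morphism [set: Q] >-> W} :=
  Morphism (in2W wreath_topM).

Lemma wreath_coord1 x : wreath_coord x 1 = 1.
Proof. exact: (morph1 (wreath_coord_morphism x)). Qed.

Lemma wreath_coord_commute x y g h : x != y ->
  commute (wreath_coord x g) (wreath_coord y h).
Proof.
move=> neq_xy; rewrite /commute !wreath_mul_baseE //; congr (_, _).
apply/ffunP => z; rewrite !ffunE /=.
by have [->|_] := eqVneq z x; rewrite ?(negPf neq_xy) ?mulg1 ?mul1g.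
Qed.

(** Conjugation [u ^ v] means [v^-1 * u * v]; the exponent is inverted to match the left action on
    [X]. *)
Lemma wreath_coordJ x q h :
  wreath_coord x h ^ wreath_top q^-1 = wreath_coord (lact to q x) h.
Proof.
have topV : wreath_top q^-1 = (wreath_top q)^-1.
  exact: (morphV wreath_top_morphism (in_setT q)).
rewrite conjgE topV invgK mulgA; apply: (canLR (mulgK _)).
rewrite wreath_mulE wreath_mul_baseE //; congr (_, _); last by rewrite mulg1.
apply/ffunP => z; rewrite !ffunE /= mul1g mulg1.
congr (if _ then _ else _); apply/eqP/eqP => [<-|->].
  by rewrite -lactM mulgV lact1.
by rewrite -lactM mulVg lact1.
Qed.

(** A base element is the product of its coordinate elements, built up along an enumeration of
    [X]. *)
Lemma mem_wreath_base (A : {group W}) (b : {ffun X -> H}) :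
  (forall x, wreath_coord x (b x) \in A) -> ((b, 1) : W) \in A.
Proof.
move=> coordA.
pose r (s : seq X) : W := ([ffun x => if x \in s then b x else 1], 1).
suffices rA s : r s \in A.
  suffices -> : ((b, 1) : W) = r (enum X) by apply: rA.
  by congr (_, _); apply/ffunP => x; rewrite ffunE mem_enum.
elim: s => [|x s IHs].
  suffices -> : r [::] = 1 by apply: group1.
  by congr (_, _); apply/ffunP => y; rewrite !ffunE.
have [xs|xNs] := boolP (x \in s).
  suffices -> : r (x :: s) = r s by [].
  congr (_, _); apply/ffunP => y; rewrite !ffunE in_cons.
  by have [->|] := eqVneq y x; rewrite ?xs.
suffices -> : r (x :: s) = wreath_coord x (b x) * r s by rewrite groupM.
rewrite wreath_mul_baseE //; congr (_, _).
apply/ffunP => y; rewrite !ffunE /= in_cons.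
by have [->|_] := eqVneq y x; rewrite ?(negPf xNs) ?mulg1 ?mul1g.
Qed.

(** The coordinate copies of [H] and the top copy of [Q] generate the group, and any homomorphic
    image of a perfect group lies in the derived subgroup. *)
Lemma perfect_wreath :
  perfect [set: H] -> perfect [set: Q] -> perfect [set: W].
Proof.
have derS (gT : finGroupType) (f : {morphism [set: gT] >-> W}) g :
    perfect [set: gT] -> f g \in [~: [set: W], [set: W]].
  move=> /eqP perf; have: g \in [~: [set: gT], [set: gT]] by rewrite perf inE.
  move=> /(mem_morphim f (in_setT g)); rewrite morphimR //.
  by apply/subsetP/commgSS; apply: subsetT.
move=> perfH perfQ; apply/eqP/setP => -[b q]; rewrite [RHS]inE.
have -> : ((b, q) : W) = ((b, 1) : W) * wreath_top q.
  rewrite wreath_mul_baseE //; congr (_, _).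
  by apply/ffunP => x; rewrite !ffunE mulg1.
rewrite groupM ?(derS _ wreath_top_morphism) //.
by apply: mem_wreath_base => x; apply: (derS _ (wreath_coord_morphism x)).
Qed.

End WreathProduct.

(** * Perfectness and level kernels in the tower *)

Section Tower.
Variables (Q : finGroupType) (X : finType) (to : {action Q &-> X}).
Local Notation W := (iter_wreath to).

Lemma perfect_iter_wreath k : perfect [set: Q] -> perfect [set: W k].
Proof.
move=> perfQ; elim: k => [|k IHk]; last exact: perfect_wreath.
by apply/eqP/setP => u; rewrite inE [u]ord1 group1.
Qed.

(* The kernel of the natural map from W(Q,k) to W(Q,n); meaningful only for
   n <= k. *)
Fixpoint level_kernel (n k : nat) : W k -> Prop :=
  match n, k return W k -> Prop with
  | n'.+1, k'.+1 => fun u => u.2 = 1 /\ forall x, level_kernel n' (u.1 x)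
  | _, _ => fun=> True
  end.

Lemma level_kernel_one n : level_kernel n (1 : W n).
Proof. by elim: n => //= n IHn; split=> // x; rewrite ffunE. Qed.

Lemma level_kernel_proj n k (u : W k.+1) : n <= k ->
  level_kernel n (iter_wreath_proj u) <-> level_kernel n u.
Proof.
elim: n k u => [|n IHn] [|k] u //= le_nk.
by split=> -[-> ku]; split=> // x; move: (ku x); rewrite ffunE IHn.
Qed.

End Tower.

(** * Schur's lemma and scalar representations of perfect groups *)

Section CommutingWithIrreducible.
Local Open Scope ring_scope.
Local Open Scope group_scope.
Lemma eq1_fix_adds (F : fieldType) n (U V A : 'M[F]_n) :
  (1%:M <= U + V)%MS -> U *m A = U -> V *m A = V -> A = 1%:M.
Proof.
case/sub_addsmxP => -[u v] /= UV1 UA VA.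
by rewrite -[A]mul1mx UV1 mulmxDl -!mulmxA UA VA.
Qed.

Variables (F : numClosedFieldType) (n : nat).

(** For an eigenvalue [a] of [A], the matrix [A - a%:M] is singular and centralizes [rG], so it
    vanishes by Schur's lemma. *)
Lemma centralizer_irreducible_scalar (gT : finGroupType) (G : {group gT})
    (rG : mx_representation F G n) A :
  mx_irreducible rG -> centgmx rG A -> is_scalar_mx A.
Proof.
move=> irrG /centgmxP cA; have [n_gt0 _] := (mx_irrP rG).1 irrG.
have [a /eigenvalueP[v vA v_neq0]] := eigenvalue_closed A n_gt0.
apply/is_scalar_mxP; exists a; apply/eqP; rewrite -subr_eq0.
apply: contraT => Aa_neq0.
have /(mx_Schur irrG)/(_ Aa_neq0) Aa_unit : centgmx rG (A - a%:M).
  by apply/centgmxP => x Gx; rewrite mulmxBl mulmxBr cA // scalar_mxC.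
case/eqP: v_neq0; apply: (row_free_inj (A := A - a%:M)).
  by rewrite row_free_unit.
by rewrite mul0mx mulmxBr vA mul_mx_scalar subrr.
Qed.

(** Scalar matrices commute, so the kernel contains all commutators, which generate a perfect
    group. *)
Lemma perfect_scalar_trivial (gT : finGroupType)
    (rG : mx_representation F [set: gT] n) :
  perfect [set: gT] -> (forall x, is_scalar_mx (rG x)) ->
  forall x, rG x = 1%:M.
Proof.
move=> /eqP perf scalG x.
suffices: x \in rker rG by case/rkerP.
have: x \in [~: [set: gT], [set: gT]] by rewrite perf inE.
apply: subsetP; rewrite gen_subG; apply/subsetP => _ /imset2P[a b _ _ ->].
apply/rkerP; split; first by rewrite inE.
have cab : rG (a * b) = rG (b * a).
  have [c ac] := is_scalar_mxP (scalG a).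
  by rewrite !repr_mxM ?inE // ac scalar_mxC.
have -> : [~ a, b] = (b * a)^-1 * (a * b).
  by rewrite commgEl conjgE invMg !mulgA.
by rewrite repr_mxM ?inE // cab -repr_mxM ?inE // mulVg repr_mx1.
Qed.

End CommutingWithIrreducible.

(** * Representations of small degree of the finite levels *)

Section SmallDegree.
Local Open Scope ring_scope.
Local Open Scope group_scope.
Variables (F : numClosedFieldType) (Q : finGroupType) (X : finType).
Variable to : {action Q &-> X}.

Lemma pchar_numClosed_group (gT : finGroupType) (G : {group gT}) :
  [pchar F]^'.-group G.
Proof. by apply/pgroupP => p _ _; rewrite inE /= pchar_num. Qed.

Section Coordinates.
Variables (H : finGroupType) (m : nat).
Variable rG : mx_representation F [set: wreath H to] m.

Lemma coord_mx_repr x :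
  mx_repr [set: H] (fun h => rG (wreath_coord to x h)).
Proof.
split=> [|g h _ _]; first by rewrite wreath_coord1 repr_mx1.
by rewrite wreath_coordM repr_mxM ?inE.
Qed.

Definition coord_repr x : mx_representation F [set: H] m :=
  MxRepresentation (coord_mx_repr x).

Lemma base_trivial_of_coord (b : {ffun X -> H}) :
  (forall x, rG (wreath_coord to x (b x)) = 1%:M) -> rG (b, 1) = 1%:M.
Proof.
move=> triv; have /rkerP[] // : ((b, 1) : wreath H to) \in rker rG.
by apply: mem_wreath_base => x; apply/rkerP; rewrite inE.
Qed.

(* The other coordinate subgroups commute with the irreducible one, hence act
   by scalars, hence trivially; the top group conjugates them to all. *)
Lemma base_trivial_of_irreducible_coord x0 (b : {ffun X -> H}) :
    (1 < #|X|)%N -> [transitive [set: Q], on [set: X] | to] ->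
    perfect [set: H] -> mx_irreducible (coord_repr x0) ->
  rG (b, 1) = 1%:M.
Proof.
move=> X_gt1 trQ perfH irr0.
have [y neq_y0] : exists y, y != x0.
  have: (0 < #|[set~ x0]|)%N by rewrite cardsC1 -subn1 subn_gt0.
  by case/card_gt0P => y; rewrite !inE; exists y.
have triv_y : forall h, coord_repr y h = 1%:M.
  apply: perfect_scalar_trivial => // h.
  apply: centralizer_irreducible_scalar irr0 _.
  apply/centgmxP => g _; rewrite /= -!repr_mxM ?inE //.
  by rewrite wreath_coord_commute.
apply: base_trivial_of_coord => x.
have [q _ xE] : exists2 q, q \in [set: Q] & x = to y q.
  by apply: (atransP2 trQ); rewrite inE.
have -> : x = lact to q^-1 y by rewrite /lact invgK.
rewrite -wreath_coordJ.
have : wreath_coord to y (b (lact to q^-1 y)) \in rker rG.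
  by apply/rkerP; rewrite inE; split=> //; apply: triv_y.
rewrite -(memJ_norm _ (subsetP (rker_norm rG) (wreath_top H to q^-1^-1) _)).
  by case/rkerP.
by rewrite inE.
Qed.

End Coordinates.

(** Induction on [n] with [k] and [m] free: the coordinates of an element of level kernel [n.+1] lie
    in level kernel [n], and a reducible coordinate representation splits into summands of degree at
    most [n]. *)
Lemma iter_wreath_level_kernel_trivial n k m
    (rG : mx_representation F [set: iter_wreath to k] m) u :
    (1 < #|X|)%N -> [transitive [set: Q], on [set: X] | to] ->
    perfect [set: Q] -> (m <= n)%N -> level_kernel n u ->
  rG u = 1%:M.
Proof.
move=> X_gt1 trQ perfQ.
elim: n k m rG u => [|n IHn] [|k] m rG u le_mn.
- move: le_mn rG; rewrite leqn0 => /eqP-> rG _.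
  by rewrite [LHS]flatmx0 [RHS]flatmx0.
- move: le_mn rG; rewrite leqn0 => /eqP-> rG _.
  by rewrite [LHS]flatmx0 [RHS]flatmx0.
- by move=> _; rewrite [u]ord1; apply: (repr_mx1 rG).
case: u => b q /= [-> kb].
have [[x0 irr0]|Nirr] := pselect (exists x, mx_irreducible (coord_repr rG x)).
  apply: base_trivial_of_irreducible_coord irr0 => //.
  exact: perfect_iter_wreath.
apply: base_trivial_of_coord => x; set rH := coord_repr rG x.
rewrite -[LHS]/(rH (b x)).
(* Degree 0 is set apart because a simple module is required to be nonzero. *)
have [m0|m_neq0] := eqVneq (1%:M : 'M[F]_m) 0.
  by rewrite -[LHS]mulmx1 m0 mulmx0.
have [V /and4P[modV _ V_neq0 ltV]] : mxnonsimple rH 1%:M.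
  apply: contrapT => simple1; apply: Nirr; exists x.
  by apply/mxsimpleP; split; rewrite ?mxmodule1.
have /(_ V modV (submx1 V)) [W modW VW1 dxVW] :=
  mx_Maschke_pchar rH (pchar_numClosed_group _).
have fixed (U : 'M_m) (modU : mxmodule rH U) :
    (\rank U <= n)%N -> U *m rH (b x) = U.
  move=> rkU; have: b x \in rstab rH U.
    rewrite -(rker_submod modU); apply/rkerP; rewrite inE; split=> //.
    exact: IHn.
  by rewrite inE => /andP[_ /eqP].
rewrite mxrank1 in ltV.
apply: (eq1_fix_adds (U := V) (V := W)); first by rewrite VW1.
  by apply: fixed => //; rewrite -ltnS (leq_trans ltV).
(* The complement [W] is proper because [V] is nonzero. *)
apply: fixed => //; rewrite -ltnS; apply: leq_trans le_mn.
have rk : (\rank V + \rank W = m)%N.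
  by have := mxrank1 F m; rewrite -VW1 (mxdirectP dxVW).
by rewrite -[ltnRHS]rk -[ltnLHS]add0n ltn_add2r lt0n mxrank_eq0.
Qed.

End SmallDegree.

(** * The general linear group has no small subgroups *)

Section NoSmallSubgroups.
Local Open Scope ring_scope.
Local Open Scope classical_set_scope.

(** This norm is submultiplicative; its values stay in [K], so complex matrices are compared in the
    partial order of the complex numbers. *)
Definition mx_l1norm (K : numDomainType) m n (A : 'M[K]_(m, n)) : K :=
  \sum_i \sum_j `|A i j|.

Lemma mx_l1norm_ge0 (K : numDomainType) m n (A : 'M[K]_(m, n)) :
  0 <= mx_l1norm A.
Proof. by apply: sumr_ge0 => i _; apply: sumr_ge0. Qed.

Lemma mx_l1norm_eq0 (K : numDomainType) m n (A : 'M[K]_(m, n)) :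
  mx_l1norm A = 0 -> A = 0.
Proof.
move/eqP; rewrite psumr_eq0 => [/allP A0|i _]; last exact: sumr_ge0.
apply/matrixP => i j; rewrite mxE; apply/eqP; rewrite -normr_eq0.
have /eqP/eqP := A0 i (mem_index_enum _); rewrite /= psumr_eq0 //.
by move=> /allP/(_ j (mem_index_enum _)).
Qed.

Lemma mx_l1normD (K : numDomainType) m n (A B : 'M[K]_(m, n)) :
  mx_l1norm (A + B) <= mx_l1norm A + mx_l1norm B.
Proof.
rewrite -big_split ler_sum // => i _; rewrite -big_split ler_sum // => j _.
by rewrite mxE ler_normD.
Qed.

Lemma mx_l1normN (K : numDomainType) m n (A : 'M[K]_(m, n)) :
  mx_l1norm (- A) = mx_l1norm A.
Proof. by apply: eq_bigr => i _; apply: eq_bigr => j _; rewrite mxE normrN. Qed.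

Lemma mx_l1normMn (K : numDomainType) m n (A : 'M[K]_(m, n)) k :
  mx_l1norm (A *+ k) = mx_l1norm A *+ k.
Proof.
rewrite -sumrMnl; apply: eq_bigr => i _; rewrite -sumrMnl.
by apply: eq_bigr => j _; rewrite mulmxnE normrMn.
Qed.

Lemma mx_l1normM (K : numDomainType) m n p (A : 'M[K]_(m, n))
    (B : 'M[K]_(n, p)) :
  mx_l1norm (A *m B) <= mx_l1norm A * mx_l1norm B.
Proof.
have rowB k : \sum_j `|B k j| <= mx_l1norm B.
  rewrite [leRHS](bigD1 k) //= lerDl.
  by apply: sumr_ge0 => i _; apply: sumr_ge0.
rewrite mulr_suml; apply: ler_sum => i _; rewrite mulr_suml.
apply: (@le_trans _ _ (\sum_k `|A i k| * \sum_j `|B k j|)); last first.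
  by apply: ler_sum => k _; apply: ler_wpM2l.
rewrite (eq_bigr _ (fun k _ => mulr_sumr _ _ _ _)) exchange_big /=.
apply: ler_sum => j _; rewrite mxE; apply: le_trans (ler_norm_sum _ _ _) _.
by apply: ler_sum => k _; rewrite normrM.
Qed.

(* [A^2 - 1 = 2(A - 1) + (A - 1)^2] forces the distance to 1 to grow under
   squaring. *)
Lemma l1norm_sub1_sqr (K : numFieldType) n (A : 'M[K]_n) :
  mx_l1norm (A - 1%:M) <= 2^-1 ->
  mx_l1norm (A - 1%:M) * 3 <= mx_l1norm (A *m A - 1%:M) * 2.
Proof.
set B := A - 1%:M => leB.
have A2 : A *m A - 1%:M = B *+ 2 + B *m B.
  have -> : A = 1%:M + B by rewrite addrC subrK.
  rewrite mulmxDl !mulmxDr !mul1mx mulmx1 mulr2n; set C := B *m B.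
  by apply: (canLR (addrK _)); rewrite [RHS]addrC !addrA.
have le2B : mx_l1norm B *+ 2 <= mx_l1norm (A *m A - 1%:M) + mx_l1norm B ^+ 2.
  rewrite -mx_l1normMn; have -> : B *+ 2 = A *m A - 1%:M - B *m B.
    by rewrite A2 addrK.
  apply: le_trans (mx_l1normD _ _) _; rewrite lerD2l mx_l1normN.
  exact: mx_l1normM.
have leB2 : mx_l1norm B ^+ 2 <= mx_l1norm B * 2^-1.
  by rewrite expr2 ler_wpM2l // mx_l1norm_ge0.
have := le_trans le2B (lerD (lexx _) leB2).
rewrite -lerBlDr => le; apply: le_trans (ler_wpM2r (ler0n _ 2) le).
by rewrite le_eqVlt; apply/orP; left; apply/eqP; field.
Qed.

Lemma nbhs_l1norm (K : numFieldType) (T : topologicalType) n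
    (f : T -> 'M[K]_n) t :
  {for t, continuous f} -> nbhs t [set s | mx_l1norm (f s - f t) <= 2^-1].
Proof.
(* The [n * n] entries, each within [e], sum to at most 1/2; the successor keeps the denominator
   nonzero for [n = 0]. *)
pose e : K := 2^-1 / (n * n).+1%:R.
have e_gt0 : 0 < e by rewrite divr_gt0 ?invr_gt0 ?ltr0n.
move=> /(_ _ (nbhsx_ballx (f t) e e_gt0)) nb.
apply: (@filterS _ (nbhs t) _ _ _ _ nb) => s [_ close].
apply: (@le_trans _ _ (\sum_(i < n) \sum_(j < n) e)).
  apply: ler_sum => i _; apply: ler_sum => j _.
  by rewrite !mxE distrC; apply/ltW/close.
rewrite !sumr_const !card_ord -mulrnA -[e *+ _]mulr_natr /e -mulrA.
rewrite ler_piMr ?invr_ge0 ?ler0n // mulrC ler_pdivrMr ?ltr0n // mul1r ler_nat.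
exact: leqnSn.
Qed.

(** A nonnegative complex number is real, so the archimedean property of [R] applies to its real
    part. *)
Lemma archi_complex_eq0 (R : realType) (z : cplx R) :
  0 <= z -> (forall k : nat, z * k%:R <= 1) -> z = 0.
Proof.
move=> z_ge0 zk; have zE := RRe_real (ger0_real z_ge0).
set a := complex.Re z in zE; have a_ge0 : 0 <= a.
  by rewrite -lecR zE.
have ak k : a * k%:R <= 1.
  rewrite -lecR (rmorphM (real_complex R)) (rmorph_nat (real_complex R)).
  by rewrite (rmorph1 (real_complex R)); move: (zk k); rewrite -{1}zE.
have [a0|a_neq0] := eqVneq a 0; first by rewrite -zE a0 rmorph0.
have a_gt0 : 0 < a by rewrite lt_def a_neq0.
have := archi_boundP (ltW (etrans (invr_gt0 a) a_gt0)).
rewrite -(ltr_pM2l a_gt0) mulfV // => /lt_geF.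
by rewrite ak.
Qed.

Lemma no_small_square_closed (R : realType) n (S : set 'M[cplx R]_n) :
    (forall A, S A -> S (A *m A)) ->
    (forall A, S A -> mx_l1norm (A - 1%:M) <= 2^-1) ->
  forall A, S A -> A = 1%:M.
Proof.
move=> SM Sle A SA.
(* The bound 1/(k+2) on all of [S], applied to [B *m B], gives 2/(3(k+2)) for [B], which is at most
   1/(k+3). The start is the hypothesis 1/2. *)
have le1 k : forall B, S B -> mx_l1norm (B - 1%:M) * (k.+2)%:R <= 1.
  elim: k => [|k IHk] B SB.
    by rewrite -ler_pdivlMr ?ltr0n // mul1r Sle.
  have := IHk _ (SM _ SB); have := l1norm_sub1_sqr (Sle _ SB).
  have := mx_l1norm_ge0 (B - 1%:M).
  move: (mx_l1norm _) (mx_l1norm _) => y x x_ge0 le_xy le_y.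
  have le2 : x * 3 * k.+2%:R <= 2.
    apply: le_trans (ler_wpM2r (ler0n _ _) le_xy) _.
    by rewrite mulrAC -[leRHS]mul1r ler_wpM2r ?ler0n.
  rewrite -(ler_pM2r (x := 2)) ?ltr0n // mul1r; apply: le_trans le2.
  by rewrite -!mulrA -!natrM ler_wpM2l // ler_nat; lia.
apply/eqP; rewrite -subr_eq0; apply/eqP/mx_l1norm_eq0/archi_complex_eq0.
  exact: mx_l1norm_ge0.
move=> k; apply: le_trans (le1 k _ SA).
by rewrite ler_wpM2l ?mx_l1norm_ge0 // ler_nat; apply: leqW.
Qed.

End NoSmallSubgroups.

(** * Neighbourhoods in the inverse limit *)

Section InverseLimitTopology.
Local Open Scope classical_set_scope.
Variable G : nat -> finGroupType.
Variable f : forall k, {multiplicative G k.+1 -> G k}.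
Local Notation L := (invlim f).
Implicit Types g h : L.

Lemma invlim_proj_eq_le g h j k : j <= k ->
  invlim_proj k g = invlim_proj k h -> invlim_proj j g = invlim_proj j h.
Proof.
elim: k => [|k IHk]; first by rewrite leqn0 => /eqP->.
rewrite leq_eqVlt => /predU1P[-> //|/IHk + gh]; apply.
by rewrite -(invlim_projP _ g) gh invlim_projP.
Qed.

(** The sets of points agreeing with [g] at level [k] are nested, hence generate a filter, and that
    filter converges to [g]. *)
Lemma nbhs_invlim g (A : set L) : nbhs g A ->
  exists k, forall h, invlim_proj k h = invlim_proj k g -> A h.
Proof.
pose K k : set L := [set h | invlim_proj k h = invlim_proj k g].
pose F : set_system L := filter_from [set: nat] K.
have FF : Filter F.
  apply: filter_from_filter; first by exists 0.
  move=> j k _ _; exists (maxn j k) => // h hg.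
  by split; apply: invlim_proj_eq_le hg; rewrite ?leq_maxl ?leq_maxr.
have Fg : F --> g by apply: cvg_invlim => k; exists k.
by move=> /Fg[k _ KA]; exists k.
Qed.

Lemma invlim_projM k g h :
  invlim_proj k (g * h) = invlim_proj k g * invlim_proj k h.
Proof. by []. Qed.

End InverseLimitTopology.

(** * Lifting elements of finite levels to the profinite group *)

Section Lifting.
Variables (Q : finGroupType) (X : finType) (to : {action Q &-> X}).
Local Notation W := (iter_wreath to).

(* On the k-level tree, u is extended to m levels by trivial local permutations
   below level k, or truncated if m < k. *)
Fixpoint wreath_lift (k m : nat) : W k -> W m :=
  match k, m return W k -> W m with
  | k'.+1, m'.+1 => fun u => ([ffun x => wreath_lift m' (u.1 x)], u.2)
  | _, _ => fun=> 1
  end.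

Lemma wreath_liftP k m (u : W k) :
  iter_wreath_proj (wreath_lift m.+1 u) = wreath_lift m u.
Proof.
elim: m k u => [|m IHm] [|k] u //=.
- by congr (_, _); apply/ffunP => x; rewrite !ffunE; apply: (IHm 0 1).
- by congr (_, _); apply/ffunP => x; rewrite !ffunE IHm.
Qed.

Lemma wreath_lift_id k (u : W k) : wreath_lift k u = u.
Proof.
elim: k u => [|k IHk] /= [b q]; first by apply/esym/ord1.
by congr (_, _); apply/ffunP => x; rewrite ffunE IHk.
Qed.

(** A section of [invlim_proj k]: it shows surjectivity and supplies representatives for factoring
    representations. *)
Definition Wprof_lift k (u : W k) : Wprof to :=
  mk_invlim (fun m => wreath_liftP m u).

Lemma Wprof_liftK k (u : W k) : invlim_proj k (Wprof_lift u) = u.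
Proof. exact: wreath_lift_id. Qed.

(** Links the recursively defined [level_kernel] to the kernel of the projection, climbing one level
    at a time from [k = n]. *)
Lemma level_kernel_invlim_proj n k (g : Wprof to) :
  invlim_proj n g = 1 -> n <= k -> level_kernel n (invlim_proj k g).
Proof.
move=> g1; elim: k => [|k IHk].
  by rewrite leqn0 => /eqP n0; rewrite n0 in g1 *.
rewrite leq_eqVlt => /predU1P[<-|le_nk].
  by rewrite g1; apply: level_kernel_one.
have := level_kernel_proj (invlim_proj k.+1 g : iter_wreath to k.+1) le_nk.
by move=> lk; apply: lk.1; rewrite (invlim_projP k g); apply: IHk.
Qed.

End Lifting.

(** * Continuous representations factor through finite levels *)

Section Factorization.
Local Open Scope ring_scope.
Local Open Scope group_scope.
Variables (R : realType) (Q : finGroupType) (X : finType).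
Variable to : {action Q &-> X}.
Local Notation C := (cplx R).
Local Notation W := (Wprof to).

Lemma factor_rep_through n (rho : W -> 'M[C]_n) k :
    linear_rep rho -> (forall g, invlim_proj k g = 1 -> rho g = 1%:M) ->
  exists rG : mx_representation C [set: iter_wreath to k] n,
    forall g, rho g = rG (invlim_proj k g).
Proof.
case=> rho1 rhoM ker.
have rho_eq g h : invlim_proj k g = invlim_proj k h -> rho g = rho h.
  move=> gh; rewrite -[LHS]mulmx1 -rho1 -(mulVg h) rhoM mulmxA -rhoM.
  rewrite [rho _]ker ?mul1mx //.
  by rewrite -[LHS]/(invlim_proj k g * (invlim_proj k h)^-1) gh mulgV.
have repW : mx_repr [set: iter_wreath to k] (fun u => rho (Wprof_lift u)).
  split=> [|u v _ _]; first by apply: ker; rewrite Wprof_liftK.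
  by rewrite -rhoM; apply: rho_eq; rewrite invlim_projM !Wprof_liftK.
by exists (MxRepresentation repW) => g; apply: rho_eq; rewrite Wprof_liftK.
Qed.

(** By continuity some open subgroup is mapped within 1/2 of the identity; its image is closed under
    squaring, hence trivial. *)
Lemma continuous_rep_open_kernel n (rho : W -> 'M[C]_n) :
    linear_rep rho -> continuous rho ->
  exists k, forall g, invlim_proj k g = 1 -> rho g = 1%:M.
Proof.
case=> rho1 rhoM rho_cont.
have /nbhs_invlim[k Bk] := nbhs_l1norm (rho_cont (1 : W)).
exists k => g gk.
pose S : set 'M[C]_n :=
  [set A | exists2 h, invlim_proj k h = 1 & A = rho h]%classic.
apply: (@no_small_square_closed _ _ S); last by exists g.
  move=> _ [h hk ->]; exists (h * h); last by rewrite rhoM.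
  by rewrite invlim_projM hk mulg1.
by move=> _ [h hk ->]; rewrite -rho1; apply: Bk.
Qed.

End Factorization.

(** * Finiteness of classes factoring through a finite quotient *)

Section FiniteQuotientReps.
Local Open Scope ring_scope.
Local Open Scope group_scope.
Variables (R : realType) (G : topologicalGroupType) (H : finGroupType).
Variables (pr : G -> H) (n : nat).
Hypothesis pr_surj : forall h, exists g, pr g = h.
Local Notation C := (cplx R).
Implicit Types (rho sigma : G -> 'M[C]_n) (rG : mx_representation C [set: H] n).

(* An invariant row space U has the invariant column space {v | U v = 0}. *)
Lemma irreducible_rep_mx_irreducible rho rG :
  (forall g, rho g = rG (pr g)) -> irreducible_rep rho -> mx_irreducible rG.
Proof.
move=> rhoE [n_gt0 irr]; apply/mx_irrP; split=> // U modU U_neq0.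
pose V := lker (linfun (mulmx U : 'cV[C]_n -> 'cV[C]_n)).
have memV v : (v \in V) = (U *m v == 0) by rewrite memv_ker lfunE.
case: (irr V) => [g v||VT].
- rewrite !memV mulmxA rhoE => /eqP Uv.
  have /submxP[D ->] := mxmoduleP modU (pr g) (in_setT _).
  by rewrite -mulmxA Uv mulmx0.
- move=> V0; rewrite -sub1mx submxE mul1mx; apply/eqP/matrixP => i j.
  have : col j (cokermx U) \in V.
    by rewrite memV colE mulmxA mulmx_coker mul0mx.
  by rewrite V0 memv0 => /eqP/matrixP/(_ i 0); rewrite !mxE.
- case/eqP: U_neq0; apply/matrixP => i j.
  have : col j 1%:M \in V by rewrite VT memvf.
  rewrite memV colE mul1mx -colE => /eqP/matrixP/(_ i 0).
  by rewrite !mxE.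
Qed.

(** [mx_rsim] places intertwiners on the right of the first representation, so [P] is a similarity
    from [rG'] to [rG]; hence the symmetry steps. *)
Lemma mx_rsim_equivalent_rep rho sigma rG rG' :
    (forall g, rho g = rG (pr g)) -> (forall g, sigma g = rG' (pr g)) ->
  mx_rsim rG rG' <-> equivalent_rep rho sigma.
Proof.
move=> rhoE sigmaE; split=> [/mx_rsim_sym[P _ freeP cP]|[P unitP cP]].
  exists P; first by rewrite -row_free_unit.
  by move=> g; rewrite rhoE sigmaE cP ?inE.
apply: mx_rsim_sym; exists P => //; first by rewrite row_free_unit.
by move=> h _; have [g <-] := pr_surj h; rewrite -rhoE -sigmaE cP.
Qed.

(** The irreducible components of the regular representation, indexed by [sH], are finite in number,
    and each class is determined by one index. *)
Lemma finite_cont_irr_classes :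
    (forall rho, linear_rep rho -> continuous rho ->
       exists rG, forall g, rho g = rG (pr g)) ->
  finite_set (@cont_irr_classes R G n).
Proof.
move=> factor.
have C'H : [pchar C]^'.-group [set: H] := pchar_numClosed_group C _.
pose sH : irrType C [set: H] := DecSocleType (regular_repr C [set: H]).
have [F FE] : exists F : sH -> set (G -> 'M[C]_n), forall i sigma,
    F i sigma <-> cont_irr_reps sigma /\
    exists2 rG : mx_representation C [set: H] n,
      forall g, sigma g = rG (pr g) & irr_comp sH rG = i.
  by eexists => i sigma; split; [exact: id | exact: id].
apply: (@sub_finite_set _ _ (F @` [set: sH])%classic); last first.
  exact: finite_image.
move=> _ [rho cirr <-]; have [lin cont irr] := cirr.
have [rG rhoE] := factor rho lin cont.
exists (irr_comp sH rG) => //; apply/seteqP; split=> sigma.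
- move=> /FE [csig [rG' sigmaE eqi]]; split; first exact: csig.
  apply/(mx_rsim_equivalent_rep rhoE sigmaE).
  have irrG := irreducible_rep_mx_irreducible rhoE irr.
  have [_ _ /(irreducible_rep_mx_irreducible sigmaE) irrG'] := csig.
  apply: mx_rsim_trans (rsim_irr_comp_pchar sH C'H irrG) _.
  rewrite -eqi; apply: mx_rsim_sym; exact: rsim_irr_comp_pchar.
- move=> [csig equiv]; apply/FE; split; first exact: csig.
  have [lin' cont' _] := csig; have [rG' sigmaE] := factor sigma lin' cont'.
  exists rG'; first exact: sigmaE.
  apply: (irr_comp_rsim_pchar sH C'H); apply: mx_rsim_sym.
  exact/(mx_rsim_equivalent_rep rhoE sigmaE).
Qed.

End FiniteQuotientReps.

Lemma rep_count_lty (R : realType) (G : topologicalGroupType) n :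
  (rep_count R G n < +oo)%E <-> finite_set (@cont_irr_classes R G n).
Proof.
rewrite /rep_count /counting; case: asboolP => fin; rewrite ?ltry ?ltxx.
  by split=> _; [exact: fin|].
by split=> [//|/fin].
Qed.

(** * Nontrivial linear characters of a group that is not perfect *)

Section Characters.
Local Open Scope ring_scope.
Local Open Scope group_scope.

(** Take a root of [1 + X + ... + X^(r-1)]; it is not 1, since the value at 1 is [r], nonzero in
    characteristic 0. *)
Lemma root_of_unity_neq1 (F : numClosedFieldType) r : (1 < r)%N ->
  exists2 z : F, (z ^+ r = 1)%R & z != 1%R.
Proof.
move=> r_gt1; pose p : {poly F} := (\poly_(i < r) 1)%R.
have sz : size p = r by apply: size_poly_eq; rewrite oner_neq0.
have /closed_rootP[z /rootP pz] : size p != 1%N.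
  by rewrite sz neq_ltn r_gt1 orbT.
have {}pz : (\sum_(i < r) z ^+ i = 0)%R.
  by rewrite -[RHS]pz horner_poly; apply: eq_bigr => i _; rewrite mul1r.
exists z; first by apply/eqP; rewrite -subr_eq0 subrX1 pz mulr0.
apply/eqP => z1; move/eqP: pz; rewrite (eq_bigr (fun=> 1%R)) => [|i _].
  by rewrite sumr_const card_ord pnatr_eq0; case: r r_gt1 {p sz}.
by rewrite z1 expr1n.
Qed.

(** A maximal subgroup [M] containing the derived subgroup is normal, with quotient generated by the
    image of any [q] outside [M]; that generator is sent to a root of unity. *)
Lemma nontrivial_character (F : numClosedFieldType) (gT : finGroupType) :
    ~~ perfect [set: gT] ->
  exists chi : gT -> F,
    [/\ {morph chi : x y / x * y >-> (x * y)%R}, chi 1 = 1%R &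
        exists q, chi q != 1%R].
Proof.
move=> Nperf.
have derT : [~: [set: gT], [set: gT]] \subset [set: gT] := subsetT _.
have [/eqP|[M maxM derM]] := maximal_exists derT.
  by rewrite -[X in X -> _]/(is_true (perfect _)) (negPf Nperf).
have nsM : M <| [set: gT] := sub_der1_normal derM (subsetT _).
have nM g : g \in 'N(M) by rewrite (subsetP (normal_norm nsM)) ?inE.
have [_ [q _ qNM]] := properP (maxgroupp maxM).
pose x := coset M q.
have /choice[l lP] : forall g, exists i, coset M g = x ^+ i.
  move=> g; have : g \in M * <[q]>.
    by rewrite (mulg_normal_maximal nsM maxM) ?inE ?subsetT ?cycle_subG.
  case/mulsgP => m _ Mm /cycleP[i ->] ->; exists i.
  by rewrite morphM ?nM // morphX ?nM //= (coset_id Mm) mul1g.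
have x_gt1 : (1 < #[x])%N.
  rewrite order_gt1; apply: contra qNM => /eqP x1.
  exact: coset_idr (nM q) x1.
have [z zr z_neq1] := root_of_unity_neq1 F x_gt1.
(* The exponents [l] are arbitrary choices; [z] sees them only modulo the order of [x]. *)
have z_mod i j : x ^+ i = x ^+ j -> (z ^+ i = z ^+ j)%R.
  move/eqP; rewrite eq_expg_mod_order => /eqP ij.
  by rewrite -(expr_mod _ zr) ij expr_mod.
exists (fun g => z ^+ l g)%R; split=> [g h||].
- by rewrite -exprD; apply: z_mod; rewrite expgD -!lP morphM ?nM.
- by apply: (z_mod _ 0%N); rewrite -lP morph1.
- by exists q; rewrite (z_mod _ 1%N) // expg1 -lP.
Qed.

End Characters.

(** * Characters attached to the levels of the tree *)

Section LevelCharacters.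
Local Open Scope ring_scope.
Local Open Scope group_scope.
Variables (F : comNzRingType) (Q : finGroupType) (X : finType).
Variables (to : {action Q &-> X}) (chi : Q -> F).
Hypothesis chiM : {morph chi : x y / x * y >-> (x * y)%R}.
Hypothesis chi1 : chi 1 = 1%R.
Local Notation W := (iter_wreath to).

(* The product of [chi] over the local permutations at the vertices of level
   j. *)
Fixpoint level_char (j k : nat) : W k -> F :=
  match k return W k -> F with
  | 0 => fun=> 1%R
  | k'.+1 => fun u =>
    if j is j'.+1 then (\prod_x level_char j' (u.1 x))%R else chi u.2
  end.

Lemma level_char1 j k : level_char j (1 : W k) = 1%R.
Proof.
elim: k j => [|k IHk] [|j] //=.
by apply: big1 => x _; rewrite ffunE IHk.
Qed.

Lemma level_charM j k : {morph @level_char j k : u v / u * v >-> (u * v)%R}.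
Proof.
elim: k j => [|k IHk] [|j] u v /=; rewrite ?mulr1 //.
(* The top component only permutes the factors of the product, so reindexing removes the shift. *)
rewrite [X in (_ * X)%R](reindex (lact to u.2^-1)) /=; last first.
  by exists (lact to u.2) => x _; rewrite -lactM ?mulgV ?mulVg lact1.
rewrite -big_split; apply: eq_bigr => x _.
by rewrite !ffunE IHk.
Qed.

(** Acts by [q] at the single vertex [x ... x] of level [j] and trivially at all others. *)
Fixpoint level_elt (x : X) (q : Q) (j : nat) : W j.+1 :=
  if j is j'.+1 then wreath_coord to x (level_elt x q j')
  else wreath_top (W 0) to q.

Lemma wreath_lift1 k m : wreath_lift m (1 : W k) = 1.
Proof.
elim: k m => [|k IHk] [|m] //=.
by congr (_, _); apply/ffunP => x; rewrite !ffunE IHk.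
Qed.

(** These elements separate the level characters. The level [i.+1] is the first that has local
    permutations at the vertices of level [i]. *)
Lemma level_char_elt x q i j :
  level_char i (wreath_lift i.+1 (level_elt x q j)) =
  if i == j then chi q else 1%R.
Proof.
elim: i j => [|i IHi] [|j] //.
  by apply: big1 => y _; rewrite !ffunE; apply: level_char1.
transitivity (\prod_y level_char i
    (wreath_lift i.+1 (if y == x then level_elt x q j else 1%g)))%R.
  by apply: eq_bigr => y _; rewrite !ffunE.
rewrite (bigD1 x) // eqxx big1 => [|y neq_yx].
  exact: etrans (mulr1 _) (IHi j).
rewrite (negPf neq_yx) -[RHS](level_char1 i i.+1); congr level_char.
exact: wreath_lift1.
Qed.

End LevelCharacters.

(** * Infinitely many classes in degree 1 *)

Section InfinitelyManyCharacters.
Local Open Scope ring_scope.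
Local Open Scope group_scope.
Variables (R : realType) (G : topologicalGroupType).
Local Notation C := (cplx R).

Lemma scalar_rep_cont_irr (lam : G -> C) :
    {morph lam : x y / x * y >-> (x * y)%R} -> lam 1 = 1%R ->
    (forall g, \forall h \near g, lam h = lam g) ->
  cont_irr_reps (fun g => (lam g)%:M : 'M[C]_1).
Proof.
move=> lamM lam1 lam_cst; split.
- by split=> [|x y]; rewrite ?lam1 // lamM scalar_mxM.
- move=> g; apply: cvg_near_cst.
  by apply: filterS (lam_cst g) => h ->.
split=> // U _; have [->|U_neq0] := eqVneq U 0%VS; [by left | right].
apply/eqP; rewrite eqEdim subvf dimvf /dim /= muln1.
by rewrite lt0n dimv_eq0.
Qed.

Lemma infinite_cont_irr_classes1 (lam : nat -> G -> C) :
    (forall j, cont_irr_reps (fun g => (lam j g)%:M : 'M[C]_1)) ->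
    injective lam ->
  ~ finite_set (@cont_irr_classes R G 1).
Proof.
move=> lam_rep lam_inj fin; apply: infinite_nat.
pose rho j g : 'M[C]_1 := (lam j g)%:M.
pose cl j : set (G -> 'M[C]_1) :=
  [set sigma | cont_irr_reps sigma /\ equivalent_rep (rho j) sigma]%classic.
have cl_inj : injective cl.
  move=> i j eq_cl; apply: lam_inj; apply/funext => g.
  have [_ [P unitP cP]] : cl i (rho j).
    rewrite eq_cl; split; first exact: lam_rep.
    by exists 1%:M => [|h]; rewrite ?unitmx1 ?mulmx1 ?mul1mx.
  (* Scalars commute with [P], so equivalence in degree 1 is equality. *)
  have := cP g; rewrite scalar_mxC => /(can_inj (mulmxK unitP)).
  by move/matrixP/(_ 0 0); rewrite !mxE.
have fin_pre : finite_set (cl @^-1` @cont_irr_classes R G 1)%classic.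
  by apply: finite_preimage fin => i j _ _; apply: cl_inj.
apply: sub_finite_set fin_pre => j _.
by exists (rho j) => //; apply: lam_rep.
Qed.

End InfinitelyManyCharacters.

(** * The two implications *)

Section Rigidity.
Local Open Scope group_scope.
Variables (R : realType) (Q : finGroupType) (X : finType).
Variable to : {action Q &-> X}.

Lemma perfect_rigid :
    1 < #|X| -> [transitive [set: Q], on [set: X] | to] ->
  perfect [set: Q] -> rigid R (Wprof to).
Proof.
move=> X_gt1 trQ perfQ n _; apply/rep_count_lty.
apply: (@finite_cont_irr_classes _ _ _ (@invlim_proj _ _ n)).
  by move=> u; exists (Wprof_lift u); apply: Wprof_liftK.
move=> rho lin cont; have [k kerk] := continuous_rep_open_kernel lin cont.
(* Level [n + k] is at least [k], so [rho] factors through it, and at least [n], so its level kernel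
   [n] is the kernel of the map to level [n]. *)
have ker g : invlim_proj (n + k) g = 1 -> rho g = 1%:M%R.
  move=> g1; apply: kerk.
  exact: (@invlim_proj_eq_le _ _ g 1 k (n + k)) (leq_addl n k) g1.
have [rG rhoE] := factor_rep_through lin ker.
apply: factor_rep_through => // g g1; rewrite rhoE.
apply: (iter_wreath_level_kernel_trivial rG (n := n)) => //.
exact: level_kernel_invlim_proj (leq_addr k n).
Qed.

Lemma rigid_perfect : 0 < #|X| -> rigid R (Wprof to) -> perfect [set: Q].
Proof.
move=> /card_gt0P[x _] rig; apply: contraT => Nperf.
have [chi [chiM chi1 [q chiq]]] := nontrivial_character (cplx R) Nperf.
pose lam j (g : Wprof to) : cplx R := level_char chi j (invlim_proj j.+1 g).
have := rig 1%N isT; move/rep_count_lty => fin; exfalso.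
apply: (infinite_cont_irr_classes1 (lam := lam)) fin => [j|i j eq_lam].
  apply: scalar_rep_cont_irr; rewrite /lam.
  - by move=> g h; apply: (level_charM chiM).
  - exact: (level_char1 to chi1 j j.+1).
  - by move=> g; apply: filterS (near_invlim_proj j.+1 g) => h ->.
have lamE k : lam k (Wprof_lift (level_elt to x q j)) =
    if k == j then chi q else 1%R by apply: level_char_elt.
apply/eqP; apply: contraNT chiq => /negPf neq_ij.
(* At the test element of level [j], [lam j] takes the value [chi q] and [lam i] the value 1. *)
by have := lamE j; rewrite eqxx -eq_lam lamE neq_ij => <-.
Qed.

End Rigidity.

Theorem theorem2 (R : realType) (Q : finGroupType) (X : finType)
    (to : {action Q &-> X}) (d : nat) (cardX : #|X| = d) (d_ge2 : 2 <= d)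
    (trQ : [transitive [set: Q], on [set: X] | to]) :
  perfect [set: Q] <-> rigid R (Wprof to).
Proof.
move: d_ge2; rewrite -cardX => X_ge2; split; first exact: perfect_rigid.
exact: rigid_perfect (ltnW X_ge2).
Qed.
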